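(* Let $n\ge2$, let $\mathbf{q}=(\mathbf{q}_1,\dots,\mathbf{q}_n)$ be an $n$-body configuration with masses $m_1,\dots,m_n$, total mass $m$, center of mass $c$ and multiplier $\lambda=U/I$, and let $\bar{\mathbf{q}}=(\mathbf{q}_0,\mathbf{q}_1,\dots,\mathbf{q}_n)$ be the $(n+1)$-body configuration obtained by adding a mass $m_0$ at $\mathbf{q}_0$. Suppose that $\mathbf{q}_0\ne c$ and that $\bar{\mathbf{q}}$ is non-collinear. Then both $\bar{\mathbf{q}}$ and $\mathbf{q}$ are central if and only if the following two conditions hold: (i) $\mathbf{q}$ is central; (ii) $\dfrac{1}{|\mathbf{q}_i-\mathbf{q}_0|^3}=\dfrac{\lambda}{m}$ for $i=1,\dots,n$.
   Context: All configurations are in $\mathbb{R}^3$, all masses are positive, and the bodies of a configuration occupy pairwise distinct positions. For bodies with masses $m_1,\dots,m_k$ at $\mathbf{q}_1,\dots,\mathbf{q}_k$ ($k\ge2$) put $m=\sum_i m_i$, $c=\frac1m\sum_i m_i\mathbf{q}_i$, $U=\sum_{i<j}\frac{m_im_j}{|\mathbf{q}_i-\mathbf{q}_j|}$, $I=\sum_i m_i|\mathbf{q}_i-c|^2$. The configuration is central if $\nabla U+\frac{\lambda}{2}\nabla I=0$ with $\lambda=U/I$, i.e. $\sum_{j\ne i} m_im_j\frac{\mathbf{q}_j-\mathbf{q}_i}{|\mathbf{q}_j-\mathbf{q}_i|^3}=-\lambda m_i(\mathbf{q}_i-c)$ for all $i$. In the claim, $m$, $c$, $U$, $I$, $\lambda$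 are those of the $n$-body configuration $\mathbf{q}$ (the body $m_0$ is not included). A configuration is collinear if all its bodies lie on one line. *)

(* Defs.v *)
From mathcomp Require Import all_boot all_order all_algebra.
From mathcomp Require Import reals.

Set Implicit Arguments.
Unset Strict Implicit.
Unset Printing Implicit Defensive.

Import Order.TTheory GRing.Theory Num.Theory.
Local Open Scope ring_scope.

(* The norm that MathComp-Analysis puts on row vectors is the sup norm, hence
   this explicit Euclidean one. *)
Definition enorm (R : realType) (v : 'rV[R]_3) : R :=
  Num.sqrt (\sum_(a < 3) v 0 a ^+ 2).

Section Configurations.
Variables (R : realType) (k : nat).
Implicit Types (m : 'I_k -> R) (q : 'I_k -> 'rV[R]_3).

Definition total_mass m : R := \sum_i m i.

Definition mass_center m q : 'rV[R]_3 :=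
  (total_mass m)^-1 *: \sum_i m i *: q i.

Definition potential m q : R :=
  \sum_(i < k) \sum_(j < k | (i < j)%N) m i * m j / enorm (q i - q j).

Definition inertia m q : R :=
  \sum_i m i * enorm (q i - mass_center m q) ^+ 2.

Definition multiplier m q : R := potential m q / inertia m q.

(* The i-th equation is the component along the i-th body of
   grad U + (lambda / 2) grad I = 0. *)
Definition central m q : Prop :=
  forall i : 'I_k,
    \sum_(j < k | j != i)
       (m i * m j / enorm (q j - q i) ^+ 3) *: (q j - q i)
    = - (multiplier m q * m i) *: (q i - mass_center m q).

Definition collinear q : Prop :=
  exists p v : 'rV[R]_3, v != 0 /\ forall i, exists t : R, q i = p + t *: v.

End Configurations.

(* [x0] is put at index 0 and [x i] at index i + 1. *)
Definition adjoin (T : Type) (n : nat) (x0 : T) (x : 'I_n -> T) : 'I_n.+1 -> T :=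
  fun i => if unlift ord0 i is Some j then x j else x0.

(* Main.v *)
(* Each body of [q] pulled by [q0] gives, when both configurations are central,
     (m0 s_i - mu m0 / M) (q0 - c) = (lambda - mu + m0 s_i) (q_i - c),
   where [s_i = |q_i - q0|^-3], [M = m0 + m] and [mu] is the multiplier of the
   enlarged configuration.  Some [q_i] is off the line through [q0] and [c];
   there both coefficients vanish, so [mu = lambda M / m], and then the other
   equations force [s_i = lambda / m].  Conversely (ii) turns the attraction of
   [q0] into a linear force, so the equations hold with [lambda M / m] as
   multiplier; that this is potential over inertia follows from Steiner's
   theorem. *)
Require Import Defs.
From mathcomp Require Import all_boot all_order all_algebra.
From mathcomp Require Import boolp reals.
From mathcomp Require Import ring lra.

Set Implicit Arguments.
Unset Strict Implicit.

Import Order.TTheory GRing.Theory Num.Theory.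
Local Open Scope ring_scope.

(** * Euclidean length in three-space *)

Section EuclideanNorm.
Variable R : realType.
Implicit Types u v : 'rV[R]_3.

Lemma enorm_sq v : enorm v ^+ 2 = \sum_(a < 3) v 0 a ^+ 2.
Proof. by rewrite /enorm sqr_sqrtr // sumr_ge0 // => a _; apply: sqr_ge0. Qed.

Lemma enorm_ge0 v : 0 <= enorm v.
Proof. exact: sqrtr_ge0. Qed.

Lemma enorm_gt0 v : v != 0 -> 0 < enorm v.
Proof.
move=> v0; rewrite lt_neqAle enorm_ge0 andbT eq_sym.
apply: contra v0 => /eqP e0; apply/eqP/rowP => a; rewrite mxE.
have /eqP : \sum_(a < 3) v 0 a ^+ 2 = 0 by rewrite -enorm_sq e0 expr0n.
rewrite psumr_eq0 => [/allP/(_ a)|b _]; last exact: sqr_ge0.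
by rewrite mem_index_enum sqrf_eq0 => /(_ isT) /eqP.
Qed.

Lemma enormB u v : enorm (u - v) = enorm (v - u).
Proof.
by rewrite /enorm; congr Num.sqrt; apply: eq_bigr => a _; rewrite !mxE -sqrrN opprB.
Qed.

Lemma enormZ_sq t v : enorm (t *: v) ^+ 2 = t ^+ 2 * enorm v ^+ 2.
Proof.
by rewrite !enorm_sq mulr_sumr; apply: eq_bigr => a _; rewrite mxE exprMn.
Qed.

End EuclideanNorm.

(** * Moments of inertia about arbitrary points *)

Section MassCenter.
Variables (R : realType) (k : nat) (m : 'I_k -> R) (q : 'I_k -> 'rV[R]_3).
Hypothesis mass_neq0 : total_mass m != 0.

Lemma mass_centerE : total_mass m *: mass_center m q = \sum_i m i *: q i.
Proof. by rewrite /mass_center scalerA mulfV // scale1r. Qed.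

(** Everything splits over the three coordinates. In each, the moment is a quadratic polynomial in
    the coordinate of [p], and its linear term is given by the center of mass. *)
Lemma steiner p :
  \sum_i m i * enorm (q i - p) ^+ 2
  = inertia m q + total_mass m * enorm (p - mass_center m q) ^+ 2.
Proof.
set c := mass_center m q.
have sum_enorm x : \sum_i m i * enorm (q i - x) ^+ 2
    = \sum_(a < 3) \sum_i m i * (q i 0 a - x 0 a) ^+ 2.
  rewrite exchange_big; apply: eq_bigr => i _; rewrite enorm_sq mulr_sumr.
  by apply: eq_bigr => a _; rewrite !mxE.
rewrite /inertia !sum_enorm enorm_sq mulr_sumr -big_split /=.
apply: eq_bigr => a _.
have -> : (p - c) 0 a = p 0 a - c 0 a by rewrite !mxE.
have ca : total_mass m * c 0 a = \sum_i m i * q i 0 a.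
  have := congr1 (fun v : 'rV_3 => v 0 a) mass_centerE; rewrite mxE summxE => ->.
  by apply: eq_bigr => i _; rewrite mxE.
have expand x : \sum_i m i * (q i 0 a - x) ^+ 2
    = \sum_i m i * q i 0 a ^+ 2 - 2 * x * (\sum_i m i * q i 0 a)
      + x ^+ 2 * total_mass m.
  rewrite /total_mass !mulr_sumr -sumrB -big_split /=.
  by apply: eq_bigr => i _; ring.
by rewrite !expand -ca; ring.
Qed.

End MassCenter.

(** * How mass, center, inertia, potential and forces change when a body is added *)

Section Adjoin.
Variables (R : realType) (n : nat) (m0 : R) (m : 'I_n -> R).
Variables (q0 : 'rV[R]_3) (q : 'I_n -> 'rV[R]_3).

Lemma adjoin0 T (x0 : T) (x : 'I_n -> T) : adjoin x0 x ord0 = x0.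
Proof. by rewrite /adjoin unlift_none. Qed.

Lemma adjoin_lift T (x0 : T) (x : 'I_n -> T) i : adjoin x0 x (lift ord0 i) = x i.
Proof. by rewrite /adjoin liftK. Qed.

Lemma total_mass_adjoin : total_mass (adjoin m0 m) = m0 + total_mass m.
Proof.
rewrite /total_mass big_ord_recl adjoin0; congr (_ + _).
by apply: eq_bigr => i _; rewrite adjoin_lift.
Qed.

Lemma mass_center_adjoin :
  total_mass m != 0 -> m0 + total_mass m != 0 ->
  mass_center (adjoin m0 m) (adjoin q0 q)
  = mass_center m q
    + (m0 / (m0 + total_mass m)) *: (q0 - mass_center m q).
Proof.
move=> m_neq0 M_neq0; rewrite {1}/mass_center total_mass_adjoin big_ord_recl.
under eq_bigr do rewrite !adjoin_lift.
rewrite !adjoin0 -mass_centerE //.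
move: (mass_center m q) => c.
by apply/rowP => a; rewrite !mxE; field.
Qed.

(** Steiner's theorem for the enlarged system about the old center: [q0] contributes [m0] times its
    squared distance, the shift of the center removes [m0 ^+ 2 / (m0 + total_mass m)] times it. *)
Lemma inertia_adjoin :
  total_mass m != 0 -> m0 + total_mass m != 0 ->
  inertia (adjoin m0 m) (adjoin q0 q)
  = inertia m q
    + m0 * total_mass m / (m0 + total_mass m) * enorm (q0 - mass_center m q) ^+ 2.
Proof.
move=> m_neq0 M_neq0.
have adj_neq0 : total_mass (adjoin m0 m) != 0 by rewrite total_mass_adjoin.
have := steiner (adjoin q0 q) adj_neq0 (mass_center m q).
rewrite big_ord_recl !adjoin0; under eq_bigr do rewrite !adjoin_lift.
rewrite total_mass_adjoin -/(inertia m q) (enormB (mass_center m q)).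
rewrite mass_center_adjoin // [_ + _ - _]addrAC subrr add0r enormZ_sq.
move=> /esym/(canRL (addrK _)) ->.
by field.
Qed.

Lemma potential_adjoin :
  potential (adjoin m0 m) (adjoin q0 q)
  = potential m q + \sum_i m0 * m i / enorm (q i - q0).
Proof.
rewrite /potential big_ord_recl addrC; congr (_ + _).
  apply: eq_bigr => i _; rewrite big_mkcond big_ord_recl /= add0r [RHS]big_mkcond.
  by apply: eq_bigr => j _; rewrite !adjoin_lift.
rewrite big_mkcond big_ord_recl /= add0r.
by apply: eq_bigr => j _; rewrite !adjoin0 !adjoin_lift enormB.
Qed.

Lemma force_adjoin_lift i :
  \sum_(j < n.+1 | j != lift ord0 i)
     (adjoin m0 m (lift ord0 i) * adjoin m0 m j
       / enorm (adjoin q0 q j - adjoin q0 q (lift ord0 i)) ^+ 3)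
       *: (adjoin q0 q j - adjoin q0 q (lift ord0 i))
  = (m i * m0 / enorm (q i - q0) ^+ 3) *: (q0 - q i)
    + \sum_(j < n | j != i)
        (m i * m j / enorm (q j - q i) ^+ 3) *: (q j - q i).
Proof.
rewrite big_mkcond big_ord_recl /= !adjoin0 !adjoin_lift enormB; congr (_ + _).
rewrite [RHS]big_mkcond; apply: eq_bigr => j _.
by rewrite (inj_eq lift_inj) !adjoin_lift.
Qed.

Lemma force_adjoin0 :
  \sum_(j < n.+1 | j != ord0)
     (adjoin m0 m ord0 * adjoin m0 m j
       / enorm (adjoin q0 q j - adjoin q0 q ord0) ^+ 3)
       *: (adjoin q0 q j - adjoin q0 q ord0)
  = \sum_i (m0 * m i / enorm (q i - q0) ^+ 3) *: (q i - q0).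
Proof.
rewrite big_mkcond big_ord_recl /= add0r.
by apply: eq_bigr => j _; rewrite !adjoin0 !adjoin_lift.
Qed.

Lemma off_axis (c : 'rV[R]_3) :
  q0 != c -> ~ collinear (adjoin q0 q) ->
  exists i, forall t, q i - c != t *: (q0 - c).
Proof.
move=> q0c ncol; apply: contrapT => none; apply: ncol.
exists c, (q0 - c); split; first by rewrite subr_eq0.
move=> i; case: (unliftP ord0 i) => [j|] ->.
  rewrite adjoin_lift; apply: contrapT => noj; apply: none; exists j => t.
  by apply/eqP => e; apply: noj; exists t; rewrite -e addrC subrK.
by exists 1; rewrite adjoin0 scale1r addrC subrK.
Qed.

(** * Centrality of the enlarged configuration against equal distances from [q0] *)

Hypotheses (n_gt0 : (0 < n)%N) (m0_gt0 : 0 < m0) (m_gt0 : forall i, 0 < m i).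
Hypothesis distinct : injective (adjoin q0 q).

Let c := mass_center m q.
Let s i := 1 / enorm (q i - q0) ^+ 3.
Let mu := multiplier (adjoin m0 m) (adjoin q0 q).
Let lambda := multiplier m q.
Let M := m0 + total_mass m.

Let total_gt0 : 0 < total_mass m.
Proof.
rewrite /total_mass (bigD1 (Ordinal n_gt0)) //= ltr_pwDl //.
by apply: sumr_ge0 => i _; apply: ltW.
Qed.

Let m_neq0 : total_mass m != 0. Proof. by rewrite gt_eqF. Qed.
Let M_neq0 : m0 + total_mass m != 0. Proof. by rewrite gt_eqF // addr_gt0. Qed.
Let m0_neq0 : m0 != 0. Proof. by rewrite gt_eqF. Qed.

Lemma adjoin_neq i : q i - q0 != 0.
Proof.
rewrite subr_eq0; apply/eqP => e.
have : lift ord0 i = ord0 by apply: distinct; rewrite adjoin_lift adjoin0.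
by move/eqP; rewrite eq_sym (negPf (neq_lift _ _)).
Qed.

(** In the equation of body [i] in the enlarged system, centrality of [q] replaces the mutual
    attractions by a multiple of [q i - c]; the new center is then expressed through [c] and
    [q0]. *)
Lemma central_balance :
  central (adjoin m0 m) (adjoin q0 q) -> central m q ->
  forall i, (m0 * (s i - mu / M)) *: (q0 - c) = (lambda - mu + m0 * s i) *: (q i - c).
Proof.
move=> cbar cq i.
have := cbar (lift ord0 i); rewrite force_adjoin_lift cq !adjoin_lift.
rewrite mass_center_adjoin // -/c -/lambda -/mu -/M => bal.
rewrite /s mul1r; move: (_ ^-1) bal => r.
move: lambda mu c => l u x bal.
apply/rowP => a; apply: (mulfI (lt0r_neq0 (m_gt0 i))).
have := congr1 (fun v : 'rV_3 => v 0 a) bal; rewrite !mxE => /eqP.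
rewrite -subr_eq0 => /eqP bal_a; apply/eqP; rewrite -subr_eq0 -bal_a; apply/eqP.
by field.
Qed.

Lemma central_adjoin_dist :
  q0 != c -> ~ collinear (adjoin q0 q) ->
  central (adjoin m0 m) (adjoin q0 q) -> central m q ->
  forall i, s i = lambda / total_mass m.
Proof.
move=> q0c ncol cbar cq.
have bal := central_balance cbar cq.
have [i qi_off] := off_axis q0c ncol.
have coef0 : lambda - mu + m0 * s i = 0.
  apply/eqP/negPn/negP => b0.
  (* Were the coefficient nonzero, dividing by it would put [q i] on the axis. *)
  have /eqP[] := qi_off ((lambda - mu + m0 * s i)^-1 * (m0 * (s i - mu / M))).
  by rewrite -scalerA bal scalerA mulVf // scale1r.
have si : s i = mu / M.
  have := bal i; rewrite coef0 scale0r => /eqP.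
  by rewrite scaler_eq0 [_ - _ == 0]subr_eq0 (negPf q0c) orbF mulf_eq0
    (negPf m0_neq0) subr_eq0 => /eqP.
have muE : mu = lambda / total_mass m * M.
  have lamE : lambda = mu - m0 * (mu / M) by move: coef0; rewrite si; lra.
  by rewrite lamE /M; field; rewrite ?M_neq0 m_neq0.
move=> j; have := bal j; rewrite muE mulfK // => balj.
(* For this [mu] the two coefficients of the balance coincide, so [c] cancels; this also covers
   bodies on the axis. *)
have /eqP : (m0 * (s j - lambda / total_mass m)) *: (q j - q0) = 0.
  have -> : q j - q0 = (q j - c) - (q0 - c) by rewrite opprB addrA subrK.
  rewrite scalerBr balj -scalerBl.
  have -> : m0 * (s j - lambda / total_mass m)
    - (lambda - lambda / total_mass m * M + m0 * s j) = 0 by rewrite /M; field.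
  by rewrite scale0r.
by rewrite scaler_eq0 (negPf (adjoin_neq j)) orbF mulf_eq0 (negPf m0_neq0)
  subr_eq0 => /eqP.
Qed.

(* [U = lambda * I] at the start needs [I <> 0]; the junk value [lambda = 0]
   for [I = 0] is excluded by (ii). *)
Lemma multiplier_adjoin :
  q0 != c -> (forall i, s i = lambda / total_mass m) ->
  mu = lambda / total_mass m * M.
Proof.
move=> q0c sE.
have lambda_neq0 : lambda != 0.
  have : s (Ordinal n_gt0) != 0.
    by rewrite /s mul1r invr_neq0 // expf_neq0 // gt_eqF // enorm_gt0 // adjoin_neq.
  by rewrite sE; apply: contraNneq => ->; rewrite mul0r.
have I_neq0 : inertia m q != 0.
  by apply: contraNneq lambda_neq0; rewrite /lambda /multiplier => ->; rewrite invr0 mulr0.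
have UE : potential m q = lambda * inertia m q by rewrite /lambda /multiplier divfK.
(* As [1 / r = r ^+ 2 / r ^+ 3], (ii) makes the added potential a multiple of the moment of [q]
   about [q0]. *)
have pot0 : \sum_i m0 * m i / enorm (q i - q0)
    = m0 * (lambda / total_mass m)
      * (inertia m q + total_mass m * enorm (q0 - c) ^+ 2).
  rewrite -steiner // mulr_sumr; apply: eq_bigr => i _; rewrite -(sE i) /s.
  have : enorm (q i - q0) != 0 by rewrite gt_eqF // enorm_gt0 // adjoin_neq.
  by move: (enorm _) => r r_neq0; field.
have Ibar_neq0 : inertia (adjoin m0 m) (adjoin q0 q) != 0.
  rewrite inertia_adjoin // gt_eqF // ltr_wpDl //.
    by apply: sumr_ge0 => i _; rewrite mulr_ge0 ?exprn_ge0 ?enorm_ge0 // ltW.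
  by rewrite !mulr_gt0 ?invr_gt0 ?addr_gt0 ?exprn_gt0 // enorm_gt0 // subr_eq0.
rewrite /mu /multiplier; apply: (mulIf Ibar_neq0); rewrite divfK //.
rewrite potential_adjoin inertia_adjoin // -/c UE pot0 -/M.
move: {+}lambda (inertia m q) (enorm _) => l J r.
by rewrite /M; field; rewrite ?M_neq0 m_neq0.
Qed.

Lemma dist_central_adjoin :
  q0 != c -> (forall i, s i = lambda / total_mass m) ->
  central m q -> central (adjoin m0 m) (adjoin q0 q).
Proof.
move=> q0c sE cq i.
have sE' j : (enorm (q j - q0) ^+ 3)^-1 = lambda / total_mass m.
  by rewrite -(sE j) /s mul1r.
rewrite -/mu multiplier_adjoin // mass_center_adjoin // -/M -/c.
case: (unliftP ord0 i) => [j|] ->.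
  (* Linear pulls towards [c] and [q0], in the ratio [total_mass m] to [m0], add up to one towards
     the new center. *)
  rewrite force_adjoin_lift !adjoin_lift cq sE' -/lambda -/c.
  move: lambda c => l x; apply/rowP => a; rewrite !mxE /M.
  by field; rewrite M_neq0.
rewrite force_adjoin0 !adjoin0.
(* Linear attractions on [q0] act as if all the mass sat at [c]. *)
have -> : \sum_j (m0 * m j / enorm (q j - q0) ^+ 3) *: (q j - q0)
    = (m0 * (lambda / total_mass m)) *: (total_mass m *: (c - q0)).
  rewrite scalerBr mass_centerE // scaler_suml -sumrB scaler_sumr.
  apply: eq_bigr => j _; rewrite sE' -scalerBr scalerA; congr (_ *: _).
  by rewrite mulrAC.
move: lambda c => l x; apply/rowP => a; rewrite !mxE /M.
by field; rewrite ?M_neq0 m_neq0.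
Qed.

End Adjoin.

Theorem theorem3 (R : realType) (n : nat) (m0 : R) (m : 'I_n -> R)
    (q0 : 'rV[R]_3) (q : 'I_n -> 'rV[R]_3)
    (n_ge2 : (2 <= n)%N)
    (m0_gt0 : 0 < m0)
    (m_gt0 : forall i, 0 < m i)
    (distinct : injective (adjoin q0 q))
    (q0_neq_c : q0 <> mass_center m q)
    (noncollinear : ~ collinear (adjoin q0 q)) :
  (central (adjoin m0 m) (adjoin q0 q) /\ central m q)
  <->
  (central m q
   /\ forall i : 'I_n,
        1 / enorm (q i - q0) ^+ 3 = multiplier m q / total_mass m).
Proof.
have n_gt0 : (0 < n)%N by apply: ltnW.
have q0c : q0 != mass_center m q by apply/eqP.
split=> [[cbar cq]|[cq sE]]; split=> //.
  exact: (central_adjoin_dist n_gt0 m0_gt0 m_gt0 distinct q0c noncollinear cbar cq).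
exact: dist_central_adjoin.
Qed.
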